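(* For every integer $n\geqslant 5$, the convex polytope graph $A_n$ satisfies $$\gamma_{2\text{-SRD}}(A_n)\leqslant\begin{cases}\dfrac{3n}{2}, & \text{if } n\equiv 0 \pmod 2,\\[4pt] \left\lfloor\dfrac{3n}{2}\right\rfloor+1, & \text{otherwise.}\end{cases}$$
   Context: For $n\geqslant 5$, $A_n$ is the graph with vertex set $\{a_i,b_i,c_i : i\in\{0,\ldots,n-1\}\}$ ($3n$ distinct vertices) and edge set $\{a_ia_{i+1},\ b_ib_{i+1},\ c_ic_{i+1},\ a_ib_i,\ b_ic_i,\ a_{i+1}b_i,\ b_{i+1}c_i : i\in\{0,\ldots,n-1\}\}$, with indices taken modulo $n$. All graphs are finite, simple and undirected; $N(v)$ denotes the set of neighbors of $v$ and $\Delta(G)$ the maximum degree. Let $k\geqslant 1$ be an integer with $|V(G)|\geqslant k$. An attack pattern is a set $P\subseteq V(G)$ with $|P|=k$. A function $f:V(G)\to\{0,1,\ldots,\min(\Delta(G),k)+1\}$ is a proper $k$-SRD ($k$-strong Roman domination) function if for each attack pattern $P$ every vertex $u\in P$ with $f(u)=0$ can be defended by a neighboring vertex, where each vertex $v$ with $f(v)\geqslant 2$ can defend at most $f(v)-1$ of its neighbors in $P$ labeled 0 (and vertices with label $\leqslant 1$ defend no other vertex). That is, for each $P$ there is a map $\delta_P:\{u\in P : f(u)=0\}\to V(G)$ (which may depend on $P$) such that $\delta_P(u)\in N(u)$ and $f(\delta_P(u))\geqslant 2$ for all $u$ in its domain, and $|\delta_P^{-1}(v)|\leqslant f(v)-1$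 for every $v$ with $f(v)\geqslant 2$. The weight is $\omega(f)=\sum_{v\in V(G)}f(v)$, and the $k$-SRD number is $\gamma_{k\text{-SRD}}(G)=\min\{\omega(f) : f \text{ is a proper } k\text{-SRD function on } G\}$. Here $k=2$. *)

(* Defs.v *)
From mathcomp Require Import all_boot.

Set Implicit Arguments.
Unset Strict Implicit.
Unset Printing Implicit Defensive.

(* A finite simple graph is a symmetric irreflexive relation e on a finType. *)
Section StrongRomanDomination.

Variables (T : finType) (e : rel T) (k : nat).

Definition nbhd (v : T) : {set T} := [set u | e v u].

Definition max_degree : nat := \max_(v : T) #|nbhd v|.

Definition label : Type := 'I_(minn max_degree k).+2.

Implicit Types (f : {ffun T -> label}) (P : {set T}) (d : {ffun T -> T}).

Definition to_defend f P : {set T} := [set u in P | f u == 0 :> nat].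

(* The defence map is totalized: its values outside to_defend f P are
   unconstrained and are not counted. *)
Definition is_defence f P d : bool :=
  [forall u in to_defend f P, (d u \in nbhd u) && (2 <= f (d u))] &&
  [forall v, (2 <= f v) ==> (#|[set u in to_defend f P | d u == v]| <= f v - 1)].

Definition proper_srd f : bool :=
  [forall P : {set T}, (#|P| == k) ==> [exists d, is_defence f P d]].

Definition weight f : nat := \sum_(v : T) f v.

Definition all_one : {ffun T -> label} := [ffun=> inord 1].

Lemma proper_all_one : proper_srd all_one.
Proof.
apply/forallP => P; apply/implyP => _; apply/existsP; exists [ffun u => u].
have E v : all_one v = 1 :> nat by rewrite ffunE inordK.
apply/andP; split; apply/forallP => v; last by rewrite E.
by rewrite inE E andbF.
Qed.

(* all_one is only the witness [arg min] requires: see srd_number_min. *)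
Definition srd_number : nat := weight [arg min_(f < all_one | proper_srd f) weight f].

Lemma srd_number_min :
  (exists2 f, proper_srd f & weight f = srd_number) /\
  (forall f, proper_srd f -> srd_number <= weight f).
Proof.
rewrite /srd_number; case: arg_minnP => [|f pf fmin]; first exact: proper_all_one.
by split=> //; exists f.
Qed.

End StrongRomanDomination.

Definition A_vertex (n : nat) : finType := ('I_n + 'I_n + 'I_n)%type.

Section ConvexPolytopeA.

Variable n : nat.

Definition A_a (i : 'I_n) : A_vertex n := inl (inl i).
Definition A_b (i : 'I_n) : A_vertex n := inl (inr i).
Definition A_c (i : 'I_n) : A_vertex n := inr i.

(* ordS is the successor modulo n. *)
Definition A_edges (i : 'I_n) : seq (A_vertex n * A_vertex n) :=
  [:: (A_a i, A_a (ordS i)); (A_b i, A_b (ordS i)); (A_c i, A_c (ordS i));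
      (A_a i, A_b i); (A_b i, A_c i);
      (A_a (ordS i), A_b i); (A_b (ordS i), A_c i)].

Definition A_adj : rel (A_vertex n) := fun u v =>
  [exists i, ((u, v) \in A_edges i) || ((v, u) \in A_edges i)].

Lemma A_adj_sym : symmetric A_adj.
Proof. by move=> u v; apply: eq_existsb => i; rewrite orbC. Qed.

Lemma A_adj_irr : 1 < n -> irreflexive A_adj.
Proof.
move=> n1 u; apply/negbTE/existsPn => i.
have neq : i != ordS i.
  apply/eqP => /(congr1 val) /= E; have := ltn_ord i; rewrite leq_eqVlt => /orP[].
    by move=> /eqP Ei; move: E n1; rewrite Ei modnn => i0; rewrite -Ei i0.
  by move=> /modn_small lt; move: E; rewrite lt => /n_Sn.
rewrite orbb !inE !xpair_eqE.
have ne w : (w == i) && (w == ordS i) = false.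
  by case: eqP => //= ->; apply: negbTE.
case: u => [[j|j]|j]; rewrite /A_a /A_b /A_c /eq_op /= /eq_op /= ?andbF ?orbF;
  exact: negbT (ne j).
Qed.

End ConvexPolytopeA.

Arguments A_adj : clear implicits.

(* Main.v *)
Require Import Defs.
From mathcomp Require Import all_boot.
From mathcomp Require Import zify.

(** Put the label 3 on the vertices [b_0, b_2, ...], one in every two
    consecutive columns.  Each of them can defend both attacked vertices, so the
    assignment is proper as soon as every vertex labelled 0 has a neighbour
    labelled 3.  For odd [n] the last column is left unpaired, and exactly
    [a_(n-1)] and [c_(n-2)] are not dominated; they receive the label 1. *)

Lemma proper_srd_dominating (T : finType) (e : rel T) (k : nat)
    (f : {ffun T -> label e k}) :
  0 < k -> (forall u, f u = 0 :> nat -> exists2 v, e u v & k < f v) ->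
  proper_srd f.
Proof.
move=> k_gt0 dom; apply/forallP => P; apply/implyP => /eqP cardP.
pose d := [ffun u => odflt u [pick v | e u v && (k < f v)]].
have dP u : u \in to_defend f P -> e u (d u) && (k < f (d u)).
  rewrite inE => /andP[_ /eqP /dom[v euv kv]]; rewrite ffunE.
  by case: pickP => [w //|/(_ v)]; rewrite euv kv.
apply/existsP; exists d; apply/andP; split.
  apply/forall_inP => u /dP /andP[edu kd].
  by rewrite inE edu (leq_trans _ kd).
apply/forall_inP => v _; have [kv|vk] := ltnP k (f v).
  have: #|[set u in to_defend f P | d u == v]| <= #|P|.
    by apply/subset_leq_card/subsetP => u; rewrite !inE => /andP[/andP[]].
  by rewrite cardP; lia.
(* A vertex with label between 2 and [k] is never chosen by [d], so its capacity is irrelevant. *)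
rewrite (_ : [set _ in _ | _] = set0) ?cards0 //; apply/setP => u; rewrite in_set0.
apply/negP; rewrite inE => /andP[/dP/andP[_ +] /eqP duv].
by rewrite duv; lia.
Qed.

(** This makes the cap on labels equal to 3 when [k] is 2, so that [inord] keeps the label 3. *)
Lemma A_max_degree_ge2 (n : nat) : 0 < n -> 2 <= max_degree (A_adj n).
Proof.
move=> n_gt0; pose i := Ordinal n_gt0.
apply: leq_trans (leq_bigmax (A_b i)).
rewrite (_ : 2 = #|[set A_a i; A_c i]|); last by rewrite cards2.
apply/subset_leq_card/subsetP => v; rewrite !inE => /orP[] /eqP ->;
  by apply/existsP; exists i; rewrite !inE !eqxx ?orbT.
Qed.

(** The bound [n./2.*2] is [n] for even [n] and [n - 1] for odd [n]. For even [n] the test on [a_i]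
    fails by itself, while [c_(n-1)] would pass without the guard [odd n]. *)
Definition A_label {n : nat} (v : A_vertex n) : nat :=
  match v with
  | inl (inl i) => (i == n./2.*2 :> nat)
  | inl (inr i) => if ~~ odd i && (i < n./2.*2) then 3 else 0
  | inr i => odd n && (i.+1 == n./2.*2)
  end.

Lemma A_label_le3 (n : nat) (v : A_vertex n) : A_label v <= 3.
Proof. by case: v => [[i|i]|i] /=; [case: eqP|case: ifP|case: (_ && _)]. Qed.

Lemma val_ordS (n : nat) (i : 'I_n) :
  ordS i = (if i.+1 == n then 0 else i.+1) :> nat.
Proof.
have := ltn_ord i; rewrite /= leq_eqVlt; case: eqP => [->|_ /= lt_Si].
  by rewrite modnn.
exact: modn_small.
Qed.

(** An odd column is not column 0, so stepping back to its even partner never wraps around. *)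
Lemma odd_ordS (n : nat) (i : 'I_n) :
  odd i -> exists2 j : 'I_n, ordS j = i & j.+1 = i.
Proof.
move=> oi; exists (ord_pred i); first exact: ord_predK.
by move: (val_ordS _ (ord_pred i)) oi; rewrite ord_predK; case: eqP => // _ ->.
Qed.

Lemma A_label_b (n : nat) (i : 'I_n) :
  ~~ odd i -> i < n./2.*2 -> A_label (A_b i) = 3.
Proof. by move=> /= -> ->. Qed.

Lemma A_label_dominating (n : nat) (u : A_vertex n) :
  1 < n -> A_label u = 0 -> exists2 v, A_adj n u v & A_label v = 3.
Proof.
move=> n_gt1; case: u => [[i|i]|i] /=; have ltin := ltn_ord i.
- move=> Ei; have [oi|ei] := boolP (odd i).
    have [j Ej vj] := odd_ordS _ i oi.
    exists (A_b j); last by apply: A_label_b; lia.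
    by apply/existsP; exists j; rewrite !inE Ej !eqxx ?orbT.
  exists (A_b i); last by apply: A_label_b; lia.
  by apply/existsP; exists i; rewrite !inE !eqxx ?orbT.
- move=> Ei; have [oi|ei] := boolP (odd i).
    have [j Ej vj] := odd_ordS _ i oi.
    exists (A_b j); last by apply: A_label_b; lia.
    by apply/existsP; exists j; rewrite !inE Ej !eqxx ?orbT.
  (* An even [i] with [b_i] labelled 0 must be the unpaired column [n - 1], whose successor is
     column 0. *)
  have vj : ordS i = 0 :> nat.
    by rewrite val_ordS; move: Ei; case: ifP; case: eqP; lia.
  exists (A_b (ordS i)); last by apply: A_label_b; rewrite vj; lia.
  by apply/existsP; exists i; rewrite !inE !eqxx ?orbT.
- move=> Ei; have [/andP[ei lti]|next] := boolP (~~ odd i && (i < n./2.*2)).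
    exists (A_b i); last exact: A_label_b.
    by apply/existsP; exists i; rewrite !inE !eqxx ?orbT.
  (* Either [i] is [n - 1] and the successor is [b_0], or [i] is odd and [i + 1] is a paired even
     column: [Ei] rules out [i = n - 2] for odd [n]. *)
  exists (A_b (ordS i)); last first.
    by apply: A_label_b; rewrite val_ordS; case: eqP; lia.
  by apply/existsP; exists i; rewrite !inE !eqxx ?orbT.
Qed.

Lemma sum_even_const (m c : nat) :
  \sum_(0 <= i < m.*2) (if ~~ odd i then c else 0) = m * c.
Proof.
elim: m => [|m IH]; first by rewrite big_geq.
by rewrite doubleS !big_nat_recr //= IH odd_double /= mulSn; lia.
Qed.

Lemma sum_A_label (n : nat) :
  1 < n -> \sum_(v : A_vertex n) A_label v = 3 * n./2 + 2 * odd n.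
Proof.
move=> n_gt1; rewrite !big_sumType /=.
have le2n : n./2.*2 <= n by lia.
have sum_delta (m : nat) : \sum_(i < n) (i == m :> nat) = (m < n).
  rewrite -(big_mkord xpredT (fun i : nat => nat_of_bool (i == m))).
  by rewrite -big_mkcond big_nat1_eq.
have -> : \sum_(i < n) (i == n./2.*2 :> nat) = odd n.
  by rewrite sum_delta; lia.
have -> : \sum_(i < n) (odd n && (i.+1 == n./2.*2) : nat) = odd n.
  (* Passing to the predecessor is safe because [n_gt1] gives [0 < n./2.*2]. *)
  rewrite (eq_bigr (fun i : 'I_n => odd n * (i == n./2.*2.-1 :> nat))).
    by rewrite -big_distrr sum_delta /=; lia.
  by move=> i _; lia.
have -> : \sum_(i < n) (if ~~ odd i && (i < n./2.*2) then 3 else 0) = n./2 * 3.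
  rewrite -(big_mkord xpredT (fun i : nat => if ~~ odd i && (i < n./2.*2) then 3 else 0)).
  rewrite (big_cat_nat (leq0n _) le2n) //= [X in _ + X]big_nat_cond [X in _ + X]big1 ?addn0; last first.
    by move=> i; rewrite andbT => /andP[le_i _]; rewrite ltnNge le_i andbF.
  rewrite -sum_even_const; apply: eq_big_nat => i /andP[_ lt_i].
  by rewrite lt_i andbT.
by lia.
Qed.

Theorem proposition3 (n : nat) (hn : 5 <= n) :
  srd_number (A_adj n) 2 <=
    (if 2 %| n then (3 * n) %/ 2 else (3 * n) %/ 2 + 1).
Proof.
have deg : minn (max_degree (A_adj n)) 2 = 2.
  by apply/minn_idPr/A_max_degree_ge2; lia.
pose f : {ffun A_vertex n -> label (A_adj n) 2} := [ffun v => inord (A_label v)].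
have fE v : f v = A_label v :> nat.
  by rewrite ffunE inordK // deg ltnS A_label_le3.
have properf : proper_srd f.
  apply: proper_srd_dominating => // u; rewrite fE => /A_label_dominating[|v euv v3].
    by lia.
  by exists v; rewrite // fE v3.
apply: leq_trans ((srd_number_min _ _).2 f properf) _.
rewrite /weight (eq_bigr _ (fun v _ => fE v)) sum_A_label; last by lia.
(* For odd [n], [3(n - 1)/2 + 2 = (3n + 1)/2], which is the floor of [3n/2] plus 1. *)
by case: ifP; lia.
Qed.
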